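(* The open quadrant $\mathcal{Q}:=\{(x,y)\in\mathbb{R}^2 : x>0,\ y>0\}$ is a polynomial image of $\mathbb{R}^2$; that is, there exists a polynomial map $f:\mathbb{R}^2\to\mathbb{R}^2$ such that $f(\mathbb{R}^2)=\mathcal{Q}$.
   Context: A map $f=(f_1,f_2):\mathbb{R}^2\to\mathbb{R}^2$ is a polynomial map if $f_1,f_2$ are given by polynomials in two variables with real coefficients. A set $S\subset\mathbb{R}^2$ is a polynomial image of $\mathbb{R}^2$ if $S=f(\mathbb{R}^2)$ for some polynomial map $f:\mathbb{R}^2\to\mathbb{R}^2$. *)

(* Defs.v *)
From mathcomp Require Import all_boot all_order all_algebra.
From mathcomp Require Import mpoly.
From mathcomp Require Import classical_sets reals.

Set Implicit Arguments.
Unset Strict Implicit.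
Unset Printing Implicit Defensive.

Import Order.TTheory GRing.Theory Num.Theory.

Local Open Scope ring_scope.
Local Open Scope classical_set_scope.

Definition eval2 (R : realType) (P : {mpoly R[2]}) (x : R * R) : R :=
  P.@[tnth [tuple x.1; x.2]].

Definition polynomial_map (R : realType) (f : R * R -> R * R) : Prop :=
  exists P1 P2 : {mpoly R[2]},
    forall x : R * R, f x = (eval2 P1 x, eval2 P2 x).

Definition polynomial_image (R : realType) (S : set (R * R)) : Prop :=
  exists2 f : R * R -> R * R, polynomial_map f & range f = S.

Definition open_quadrant (R : realType) : set (R * R) :=
  [set p | 0 < p.1 /\ 0 < p.2].

Arguments open_quadrant : clear implicits.

(* Main.v *)
(** Write t = xy.  The quadrant is the image of R^2 under the composite of
    F(u,v) = ((uv-1)^2 + u^2, (uv-1)^2 + v^2),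
    G(x,y) = (x, y(t-2)^2 + x(t-1)^2) and H(x,y) = (x(t-2)^2 + xy^2/2, y).
    F maps into the open quadrant Q, while G and H preserve it.
    Conversely, by the intermediate value theorem in one variable,
    F reaches Q with t >= 1, from which G reaches Q with t >= 1 or x <= y,
    from which H reaches all of Q. *)
Require Import Defs.
From mathcomp Require Import all_boot all_order all_algebra.
From mathcomp Require Import mpoly ring lra.
From mathcomp Require Import classical_sets reals.

Set Implicit Arguments.
Unset Strict Implicit.
Unset Printing Implicit Defensive.

Import Order.TTheory GRing.Theory Num.Theory.

Local Open Scope ring_scope.

Lemma poly_ivt_value (R : rcfType) (p : {poly R}) (l r c : R) :
  l <= r -> p.[l] <= c <= p.[r] -> exists2 x, l <= x <= r & p.[x] = c.
Proof.
move=> ler /andP[pl pr].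
have := @poly_ivt R (p - c%:P) l r ler.
rewrite !hornerE /= subr_le0 subr_ge0 pl pr => /(_ isT) [x xlr].
by rewrite /root !hornerE subr_eq0 => /eqP; exists x.
Qed.

Section QuadrantMaps.
Variable R : realType.
Implicit Types (a b x y u v : R) (p : R * R).

Definition quadF p : R * R :=
  ((p.1 * p.2 - 1) ^+ 2 + p.1 ^+ 2, (p.1 * p.2 - 1) ^+ 2 + p.2 ^+ 2).

Definition quadG p : R * R :=
  (p.1, p.2 * (p.1 * p.2 - 2) ^+ 2 + p.1 * (p.1 * p.2 - 1) ^+ 2).

Definition quadH p : R * R :=
  (p.1 * (p.1 * p.2 - 2) ^+ 2 + 2^-1 * (p.1 * p.2 ^+ 2), p.2).

(** Substituting the components of [f] into those of [g] gives polynomials again, and evaluation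
    commutes with this substitution. *)
Lemma polynomial_map_comp (f g : R * R -> R * R) :
  polynomial_map f -> polynomial_map g -> polynomial_map (g \o f).
Proof.
move=> [P1 [P2 fE]] [Q1 [Q2 gE]].
have evalC Q (x : R * R) : eval2 Q (f x) = eval2 (Q \mPo [tuple P1; P2]) x.
  rewrite /eval2 comp_mpoly_meval; apply: meval_eq => i.
  rewrite fE /eval2.
  by case: i => [[|[|i]] ?].
exists (Q1 \mPo [tuple P1; P2]), (Q2 \mPo [tuple P1; P2]) => x.
by rewrite /= gE !evalC.
Qed.

Let X : {mpoly R[2]} := 'X_ord0.
Let Y : {mpoly R[2]} := 'X_ord_max.

Lemma eval2X p : eval2 X p = p.1. Proof. by rewrite /eval2 mevalXU. Qed.
Lemma eval2Y p : eval2 Y p = p.2. Proof. by rewrite /eval2 mevalXU. Qed.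

Let evalE := (mevalD, mevalN, mevalM, mevalC, meval1, expr2).

Lemma polynomial_quadF : polynomial_map quadF.
Proof.
exists ((X * Y - 1) ^+ 2 + X ^+ 2), ((X * Y - 1) ^+ 2 + Y ^+ 2) => p.
rewrite /quadF -eval2X -eval2Y /eval2.
by rewrite !evalE.
Qed.

Lemma polynomial_quadG : polynomial_map quadG.
Proof.
exists X, (Y * (X * Y - 2%:R%:MP) ^+ 2 + X * (X * Y - 1) ^+ 2) => p.
rewrite /quadG -eval2X -eval2Y /eval2.
by rewrite !evalE.
Qed.

Lemma polynomial_quadH : polynomial_map quadH.
Proof.
exists (X * (X * Y - 2%:R%:MP) ^+ 2 + (2^-1)%:MP * (X * Y ^+ 2)), Y => p.
rewrite /quadH -eval2X -eval2Y /eval2.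
by rewrite !evalE.
Qed.

(** The common summand [(u * v - 1) ^+ 2] vanishes only when [u * v = 1], and then [u] and [v] are
    both nonzero. *)
Lemma quadF_gt0 p : open_quadrant R (quadF p).
Proof.
case: p => u v; rewrite /open_quadrant /quadF /=.
have [uv1|uv1] := eqVneq (u * v) 1.
  have : u * v != 0 by rewrite uv1 oner_neq0.
  rewrite mulf_eq0 negb_or uv1 subrr expr0n !add0r => /andP[u0 v0].
  by split; rewrite exprn_even_gt0.
by split; rewrite ltr_wpDr ?sqr_ge0 // exprn_even_gt0 //= subr_eq0.
Qed.

(** The two squares in the second coordinate vanish at [x * y = 2] and [x * y = 1] respectively,
    hence never together. *)
Lemma quadG_gt0 p : open_quadrant R p -> open_quadrant R (quadG p).
Proof.
case: p => x y [/= x0 y0]; split => //=.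
have [->|t2] := eqVneq (x * y) 2; first by nra.
apply: ltr_wpDr; first by rewrite mulr_ge0 ?sqr_ge0 ?ltW.
by rewrite mulr_gt0 // exprn_even_gt0 //= subr_eq0.
Qed.

Lemma quadH_gt0 p : open_quadrant R p -> open_quadrant R (quadH p).
Proof.
case: p => x y [/= x0 y0]; split => //=.
apply: ltr_wpDl; first by rewrite mulr_ge0 ?sqr_ge0 ?ltW.
by rewrite !mulr_gt0 ?exprn_gt0 // invr_gt0.
Qed.

(** With [w = u * v - 1], the equations become [u ^+ 2 = a - w ^+ 2], [v ^+ 2 = b - w ^+ 2] and
    [u * v = w + 1]. Squaring the last one leaves a single equation in [w], the vanishing of [q]. *)
Lemma quadF_onto a b : 0 < a -> 0 < b -> 1 <= a * b ->
  exists p, quadF p = (a, b).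
Proof.
move=> a0 b0 ab1.
pose m := Num.sqrt (Num.min a b).
have min0 : 0 <= Num.min a b by rewrite le_min !ltW.
have m0 : 0 <= m by exact: sqrtr_ge0.
have m2 : m ^+ 2 = Num.min a b by rewrite sqr_sqrtr.
pose q : {poly R} := ('X + 1) ^+ 2 - (a%:P - 'X ^+ 2) * (b%:P - 'X ^+ 2).
have qE w : q.[w] = (w + 1) ^+ 2 - (a - w ^+ 2) * (b - w ^+ 2).
  by rewrite /q !hornerE.
(* [q] is [1 - a * b <= 0] at 0. At [m] one factor of the product vanishes, so [q] is a square
   there. *)
have [||w /andP[w0 wm]] := @poly_ivt_value R q 0 m 0 => //.
  rewrite !qE m2; apply/andP; split; first by nra.
  have -> : (a - Num.min a b) * (b - Num.min a b) = 0.
    by case: leP => _; rewrite subrr ?mul0r ?mulr0.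
  by rewrite subr0 sqr_ge0.
rewrite qE => /eqP; rewrite subr_eq0 => /eqP w_root.
have : w ^+ 2 <= Num.min a b by rewrite -m2 ler_sqr.
rewrite le_min -!(subr_ge0 (w ^+ 2)) => /andP[wa wb].
exists (Num.sqrt (a - w ^+ 2), Num.sqrt (b - w ^+ 2)).
(* The sign [0 <= w] makes [w + 1] the nonnegative root of its square. *)
have uv : Num.sqrt (a - w ^+ 2) * Num.sqrt (b - w ^+ 2) = w + 1.
  by rewrite -sqrtrM // -w_root sqrtr_sqr ger0_norm // addr_ge0.
by rewrite /quadF /= uv !sqr_sqrtr // addrK !(addrC (w ^+ 2)) !subrK.
Qed.

(** The first coordinate is fixed, so one equation in [y] remains. It is solved on an interval to
    the right of [a^-1], which yields both [0 < y] and [1 <= a * y]. *)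
Lemma quadG_onto a b : 0 < a -> 0 < b -> 1 <= a * b \/ a <= b ->
  exists y, [/\ 0 < y, 1 <= a * y & quadG (a, y) = (a, b)].
Proof.
move=> a0 b0 ab.
pose q : {poly R} := 'X * (a%:P * 'X - 2%:P) ^+ 2 + a%:P * (a%:P * 'X - 1) ^+ 2.
have qE y : q.[y] = y * (a * y - 2) ^+ 2 + a * (a * y - 1) ^+ 2.
  by rewrite /q !hornerE.
have aV : a * a^-1 = 1 by rewrite divff ?gt_eqF.
have aV0 : 0 < a^-1 by rewrite invr_gt0.
suff [l [r [lr al qlr]]] :
    exists l r, [/\ l <= r, a^-1 <= l & q.[l] <= b <= q.[r]].
  have [y /andP[ly _] qy] := poly_ivt_value lr qlr.
  exists y; split; first by apply: lt_le_trans ly; apply: lt_le_trans al.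
    by rewrite -aV ler_pM2l // (le_trans al).
  by rewrite /quadG /= -qE qy.
have q2 : q.[2 * a^-1] = a by rewrite qE (mulrCA a) aV; ring.
have [leab|ltba] := leP a b.
  (* At the right end [r], [a * r - 2 = 1 + a * b] exceeds 1, so the first summand alone is at least
     [r], hence at least [b]. *)
  exists (2 * a^-1), (3 * a^-1 + b); split; [lra|lra|].
  have e : a * (3 * a^-1 + b) = 3 + a * b by rewrite mulrDr mulrCA aV mulr1.
  rewrite q2 leab qE /= e.
  have := mulr_gt0 a0 b0; set t := a * b => t0.
  have h1 : 0 <= a * (3 + t - 1) ^+ 2 by rewrite mulr_ge0 ?sqr_ge0 ?ltW.
  have h2 : 1 <= (3 + t - 2) ^+ 2 by nra.
  by nra.
have {}ab : 1 <= a * b by case: ab => // leab; lra.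
(* At [a^-1] the second summand vanishes and the value is [a^-1], which is at most [b] because
   [1 <= a * b]. *)
exists a^-1, (2 * a^-1); split; [lra|lra|].
rewrite q2 (ltW ltba) andbT qE aV subrr expr0n mulr0 addr0.
have -> : (1 - 2 : R) ^+ 2 = 1 by ring.
by rewrite mulr1 -(ler_pM2l a0) aV.
Qed.

(** Now [b] is fixed and [x] is sought. The interval must have [1 <= x * b] or [x <= b] at each of
    its points, so it depends on how [b] compares with [a] and 1. *)
Lemma quadH_onto a b : 0 < a -> 0 < b ->
  exists x, [/\ 0 < x, 1 <= x * b \/ x <= b & quadH (x, b) = (a, b)].
Proof.
move=> a0 b0.
pose q : {poly R} :=
  'X * ('X * b%:P - 2%:P) ^+ 2 + (2^-1)%:P * ('X * (b ^+ 2)%:P).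
have qE x : q.[x] = x * (x * b - 2) ^+ 2 + 2^-1 * (x * b ^+ 2).
  by rewrite /q !hornerE.
have bV : b^-1 * b = 1 by rewrite mulVf ?gt_eqF.
have bV0 : 0 < b^-1 by rewrite invr_gt0.
suff [l [r [lr l0 good qlr]]] : exists l r, [/\ l <= r, 0 <= l,
    forall x, l <= x <= r -> 1 <= x * b \/ x <= b & q.[l] <= a <= q.[r]].
  have [x lxr qx] := poly_ivt_value lr qlr.
  exists x; split; [|exact: good|by rewrite /quadH /= -qE qx].
  rewrite lt_neqAle (le_trans l0) ?andbT; last by case/andP: lxr.
  (* [q] vanishes at 0, whereas its value at [x] is [a > 0]. *)
  apply/eqP => x0; move: qx; rewrite qE -x0; lra.
have q2 : q.[2 * b^-1] = b.
  by rewrite qE; field; rewrite gt_eqF.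
have q0 : q.[0] = 0 by rewrite qE; ring.
have [leba|ltab] := leP b a.
  exists (2 * b^-1), (3 * b^-1 + a); split; [lra|lra| |].
    move=> x /andP[x2 _]; left.
    have : 2 * b^-1 * b <= x * b by rewrite ler_pM2r.
    by rewrite -mulrA bV; lra.
  have e : (3 * b^-1 + a) * b = 3 + a * b by rewrite mulrDl -mulrA bV mulr1.
  rewrite q2 leba qE /= e.
  have := mulr_gt0 a0 b0; set t := a * b => t0.
  set s := 3 * b^-1 + a; have s0 : a <= s by rewrite /s; lra.
  have h1 : 0 <= 2^-1 * (s * b ^+ 2).
    by rewrite !mulr_ge0 ?exprn_ge0 ?invr_ge0 //; lra.
  have h2 : 1 <= (3 + t - 2) ^+ 2 by nra.
  by nra.
have [le1b|ltb1] := leP 1 b.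
  (* Since [1 <= b], a point [x <= 1] satisfies [x <= b], and a point [x > 1] satisfies
     [1 <= x * b]. *)
  exists 0, (2 * b^-1); split => //; [lra| |by rewrite q0 q2 !ltW].
  move=> x /andP[x0 _].
  have [x1|x1] := leP x 1; [right|left]; nra.
(* For [b < 1] the interval stops at [b], where [q] equals [b * ((s - 2) ^+ 2 + s / 2)] with
   [s = b ^+ 2 <= 1]. This is at least [b], hence above [a]. *)
exists 0, b; split => //; first exact: ltW.
  by move=> x /andP[_ xb]; right.
rewrite q0 (ltW a0) (le_trans (ltW ltab)) //= qE -expr2.
set s := b ^+ 2.
have s1 : s <= 1 by rewrite /s expr_le1 ?ltW.
have s0 : 0 <= s by exact: sqr_ge0.
suff : 1 <= (s - 2) ^+ 2 + 2^-1 * s by move=> h; nra.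
by nra.
Qed.

End QuadrantMaps.

Theorem theorem1p1 (R : realType) : polynomial_image (open_quadrant R).
Proof.
exists (@quadH R \o (@quadG R \o @quadF R)).
  apply: polynomial_map_comp (@polynomial_quadH R).
  exact: polynomial_map_comp (@polynomial_quadF R) (@polynomial_quadG R).
apply/seteqP; split => [_ [p _ <-]|[a b] [/= a0 b0]].
  exact/quadH_gt0/quadG_gt0/quadF_gt0.
have [x [x0 xb Hx]] := quadH_onto a0 b0.
have [y [y0 xy Gy]] := quadG_onto x0 b0 xb.
have [p Fp] := quadF_onto x0 y0 xy.
by exists p => //=; rewrite Fp Gy Hx.
Qed.
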